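(* Let $A\in\mathbb{R}^{n\times n}$ be symmetric and positive definite, and suppose that the block Lanczos algorithm is started with $A$ and the block $v=r_0\in\mathbb{R}^{n\times m}$, and that the O'Leary block CG algorithm (OL-BCG) is started with the same $A$ and with initial residual block $r_0=b-Ax_0$. Let $k\ge 1$ be such that $\dim\mathcal{K}_k(A,r_0)=km$. Let $T_k$ be the block tridiagonal matrix of block Lanczos coefficients, and let $\widetilde T_k$ be the block tridiagonal matrix built from the OL-BCG quantities and from normalization coefficients $\varrho_j=\theta_j^T\sigma_j$ with arbitrary orthogonal matrices $\theta_j\in\mathbb{R}^{m\times m}$, $j=0,\dots,k-1$ (all objects as defined in the context). Then \[ T_k=U_k^T\widetilde T_kU_k, \] where $U_k=\mathrm{diag}(\eta_1,\eta_2,\dots,\eta_k)$ is block diagonal with $m\times m$ blocks, $\eta_1=\theta_0^T$, and $\eta_{j+1}$ for $j\ge1$ are determined by \[ [\eta_{j+1},\beta_{j+1}]=\mathtt{qr}(\widetilde\beta_{j+1}\eta_j),\qquad j=1,\dots,k-1, \] where $\beta_{j+1}$ are the block Lanczos coefficients.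
   Context: All computations are in exact arithmetic. $I$ denotes the $m\times m$ identity matrix. For $v\in\mathbb{R}^{n\times m}$, $\mathcal{K}_k(A,v)=\mathrm{colspan}\{v,Av,\dots,A^{k-1}v\}$ is the span of all columns of the blocks $v,Av,\dots,A^{k-1}v$. Notation: $[Q,R]=\mathtt{qr}(B)$ means that $B=QR$ is the QR factorization of a full column rank matrix $B$ with $m$ columns, where $Q$ has orthonormal columns and has the same size as $B$, and $R$ is $m\times m$ upper triangular with positive diagonal entries. For a symmetric positive definite $G$, $\mathtt{chol}(G)$ is the upper triangular matrix $R$ with positive diagonal such that $R^TR=G$. Block Lanczos algorithm (input: symmetric $A$, $v\in\mathbb{R}^{n\times m}$): $v_0=0$; $[v_1,\beta_1]=\mathtt{qr}(v)$; for $k=1,2,\dots$: $w=Av_k-v_{k-1}\beta_k^T$; $\alpha_k=v_k^Tw$; $w\leftarrow w-v_k\alpha_k$; $[v_{k+1},\beta_{k+1}]=\mathtt{qr}(w)$. The matrix $T_k\in\mathbb{R}^{km\times km}$ is the symmetric block tridiagonal matrix with diagonal blocks $\alpha_1,\dots,\alpha_k$, subdiagonal blocks $\beta_2,\dots,\beta_k$ and superdiagonal blocks $\beta_2^T,\dots,\beta_k^T$. O'Leary block CG algorithm (OL-BCG) (input: symmetric positive definite $A$, $b\in\mathbb{R}^{n\times m}$, $x_0\in\mathbb{R}^{n\times m}$; the nonsingular matrices $\phi_k\in\mathbb{R}^{m\times m}$ can be freely chosen): $r_0=b-Ax_0$; $p_0=r_0\phi_0$; for $k=1,2,\dots$: $\gamma_{k-1}=(p_{k-1}^TAp_{k-1})^{-1}\phi_{k-1}^Tr_{k-1}^Tr_{k-1}$;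 $x_k=x_{k-1}+p_{k-1}\gamma_{k-1}$; $r_k=r_{k-1}-Ap_{k-1}\gamma_{k-1}$; $\delta_k=\phi_{k-1}^{-1}(r_{k-1}^Tr_{k-1})^{-1}r_k^Tr_k$; $p_k=(r_k+p_{k-1}\delta_k)\phi_k$. Let $\sigma_j=\mathtt{chol}(r_j^Tr_j)$ and $\varrho_j=\theta_j^T\sigma_j$ with $\theta_j\in\mathbb{R}^{m\times m}$ orthogonal (so that $r_j^Tr_j=\varrho_j^T\varrho_j$). The matrix $\widetilde T_k\in\mathbb{R}^{km\times km}$ is the block tridiagonal matrix with diagonal blocks $\widetilde\alpha_1,\dots,\widetilde\alpha_k$, subdiagonal blocks $\widetilde\beta_2,\dots,\widetilde\beta_k$ and superdiagonal blocks $\widetilde\beta_2^T,\dots,\widetilde\beta_k^T$, where $\widetilde\alpha_1=\varrho_0\gamma_0^{-1}\phi_0^{-1}\varrho_0^{-1}$ and, for $j=1,\dots,k-1$, $\widetilde\alpha_{j+1}=\varrho_j\gamma_j^{-1}\phi_j^{-1}\varrho_j^{-1}+\varrho_j\gamma_{j-1}^{-1}\delta_j\varrho_j^{-1}$ and $\widetilde\beta_{j+1}=\varrho_j\gamma_{j-1}^{-1}\phi_{j-1}^{-1}\varrho_{j-1}^{-1}$. *)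

(* Defs.v *)
From HB Require Import structures.
From mathcomp Require Import all_boot all_order all_algebra.
From mathcomp Require Import boolp classical_sets reals.

Set Implicit Arguments.
Unset Strict Implicit.
Unset Printing Implicit Defensive.

Import Order.TTheory GRing.Theory Num.Theory.
Local Open Scope ring_scope.

Definition posdef (R : realType) (n : nat) (A : 'M[R]_n) : Prop :=
  forall x : 'cV[R]_n, x != 0 -> 0 < (x^T *m A *m x) 0 0.

Definition orthogonal_mx (R : realType) (m : nat) (Q : 'M[R]_m) : Prop :=
  Q^T *m Q = 1%:M.

Definition upper_pos (R : realType) (m : nat) (S : 'M[R]_m) : Prop :=
  (forall i j : 'I_m, (j < i)%N -> S i j = 0) /\ (forall i : 'I_m, 0 < S i i).

(* [Q, S] = qr(B). These conditions force B to have full column rank. *)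
Definition is_qr (R : realType) (n m : nat)
    (B Q : 'M[R]_(n, m)) (S : 'M[R]_m) : Prop :=
  [/\ B = Q *m S, Q^T *m Q = 1%:M & upper_pos S].

(* (0, 0) when B has no QR factorization, i.e. when its columns are dependent. *)
Definition qr (R : realType) (n m : nat) (B : 'M[R]_(n, m)) :
    'M[R]_(n, m) * 'M[R]_m :=
  xget (0, 0) (fun QS : 'M[R]_(n, m) * 'M[R]_m => is_qr B QS.1 QS.2).

(* 0 when G is not symmetric positive definite. *)
Definition chol (R : realType) (m : nat) (G : 'M[R]_m) : 'M[R]_m :=
  xget 0 (fun S : 'M[R]_m => upper_pos S /\ S^T *m S = G).

Definition krylov (R : realType) (n m : nat) (k : nat)
    (A : 'M[R]_n) (v : 'M[R]_(n, m)) : {vspace 'cV[R]_n} :=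
  <<[seq col j (A ^+ i *m v) | i : 'I_k <- enum 'I_k,
                               j : 'I_m <- enum 'I_m]>>%VS.

(* The blocks are numbered from 1 (blocks a 1, ..., a k on the diagonal and
   b 2, ..., b k below it), whereas the ordinals i and j start from 0. *)
Definition block_tridiag (R : realType) (m : nat) (k : nat)
    (a b : nat -> 'M[R]_m) : 'M[R]_(\sum_(i < k) m, \sum_(j < k) m) :=
  \mxblock_(i < k, j < k)
    (if i == j :> nat then a i.+1
     else if i == j.+1 :> nat then b i.+1
     else if j == i.+1 :> nat then (b j.+1)^T
     else 0).

Definition block_diag (R : realType) (m : nat) (k : nat)
    (u : nat -> 'M[R]_m) : 'M[R]_(\sum_(i < k) m) :=
  \mxdiag_(i < k) u i.+1.

Section BlockLanczos.
Variables (R : realType) (n m : nat) (A : 'M[R]_n) (v : 'M[R]_(n, m)).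

(* The triple (v_k, v_{k+1}, beta_{k+1}). *)
Fixpoint lanczos (k : nat) : 'M[R]_(n, m) * 'M[R]_(n, m) * 'M[R]_m :=
  match k with
  | 0 => let: (v1, beta1) := qr v in (0, v1, beta1)
  | k'.+1 =>
      let: (vprev, vk, betak) := lanczos k' in
      let w := A *m vk - vprev *m betak^T in
      let alphak := vk^T *m w in
      let: (vnext, betanext) := qr (w - vk *m alphak) in
      (vk, vnext, betanext)
  end.

Definition lanczos_v (k : nat) : 'M[R]_(n, m) := (lanczos k).1.1.

(* Meaningful for k >= 1. *)
Definition lanczos_beta (k : nat) : 'M[R]_m := (lanczos k.-1).2.

(* Meaningful for k >= 1. *)
Definition lanczos_alpha (k : nat) : 'M[R]_m :=
  (lanczos_v k)^T *m
    (A *m lanczos_v k - lanczos_v k.-1 *m (lanczos_beta k)^T).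

Lemma lanczos_v0 : lanczos_v 0 = 0.
Proof. by rewrite /lanczos_v /=; case: (qr v). Qed.

Lemma lanczos_init : qr v = (lanczos_v 1, lanczos_beta 1).
Proof.
rewrite /lanczos_v /lanczos_beta /=.
by case: (qr v) => v1 b1; case: (qr _).
Qed.

Lemma lanczos_step (k : nat) : (0 < k)%N ->
  qr (A *m lanczos_v k - lanczos_v k.-1 *m (lanczos_beta k)^T
      - lanczos_v k *m lanczos_alpha k)
  = (lanczos_v k.+1, lanczos_beta k.+1).
Proof.
case: k => // k _; rewrite /lanczos_alpha /lanczos_v /lanczos_beta /=.
case: (lanczos k) => -[vp vk] bk /=.
by case E: (qr (A *m vk - _ - _)) => [q s] /=; rewrite E; case: (qr _).
Qed.

End BlockLanczos.

Section OLBCG.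
Variables (R : realType) (n m : nat) (A : 'M[R]_n) (b x0 : 'M[R]_(n, m)).
Variable phi : nat -> 'M[R]_m.

(* gamma_k in terms of r_k, p_k and phi_k. *)
Definition gamma_of (rk pk : 'M[R]_(n, m)) (phik : 'M[R]_m) : 'M[R]_m :=
  invmx (pk^T *m A *m pk) *m phik^T *m (rk^T *m rk).

(* delta_k in terms of r_{k-1}, r_k and phi_{k-1}. *)
Definition delta_of (rprev rk : 'M[R]_(n, m)) (phiprev : 'M[R]_m) : 'M[R]_m :=
  invmx phiprev *m invmx (rprev^T *m rprev) *m (rk^T *m rk).

(* The triple (x_k, r_k, p_k). *)
Fixpoint olbcg (k : nat) : 'M[R]_(n, m) * 'M[R]_(n, m) * 'M[R]_(n, m) :=
  match k with
  | 0 => let r0 := b - A *m x0 in (x0, r0, r0 *m phi 0)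
  | k'.+1 =>
      let: (x, r, p) := olbcg k' in
      let gamma := gamma_of r p (phi k') in
      let x' := x + p *m gamma in
      let r' := r - A *m p *m gamma in
      let delta := delta_of r r' (phi k') in
      (x', r', (r' + p *m delta) *m phi k'.+1)
  end.

Definition bcg_r (k : nat) : 'M[R]_(n, m) := (olbcg k).1.2.
Definition bcg_p (k : nat) : 'M[R]_(n, m) := (olbcg k).2.
Definition bcg_gamma (k : nat) : 'M[R]_m :=
  gamma_of (bcg_r k) (bcg_p k) (phi k).

(* Meaningful for k >= 1. *)
Definition bcg_delta (k : nat) : 'M[R]_m :=
  delta_of (bcg_r k.-1) (bcg_r k) (phi k.-1).

Lemma bcg_r_step (k : nat) :
  bcg_r k.+1 = bcg_r k - A *m bcg_p k *m bcg_gamma k.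
Proof. by rewrite /bcg_gamma /bcg_r /bcg_p /=; case: (olbcg k) => -[]. Qed.

Lemma bcg_p_step (k : nat) :
  bcg_p k.+1 = (bcg_r k.+1 + bcg_p k *m bcg_delta k.+1) *m phi k.+1.
Proof. by rewrite /bcg_delta /bcg_r /bcg_p /=; case: (olbcg k) => -[]. Qed.

Variable theta : nat -> 'M[R]_m.

Definition bcg_sigma (j : nat) : 'M[R]_m := chol ((bcg_r j)^T *m bcg_r j).
Definition bcg_rho (j : nat) : 'M[R]_m := (theta j)^T *m bcg_sigma j.

(* Meaningful for k >= 1. *)
Definition alpha_tilde (k : nat) : 'M[R]_m :=
  match k with
  | 0 => 0
  | 1 => bcg_rho 0 *m invmx (bcg_gamma 0) *m invmx (phi 0) *m invmx (bcg_rho 0)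
  | (j'.+1 as j).+1 =>
      bcg_rho j *m invmx (bcg_gamma j) *m invmx (phi j) *m invmx (bcg_rho j)
      + bcg_rho j *m invmx (bcg_gamma j') *m bcg_delta j *m invmx (bcg_rho j)
  end.

(* Meaningful for k >= 2. *)
Definition beta_tilde (k : nat) : 'M[R]_m :=
  match k with
  | 0 | 1 => 0
  | (j'.+1 as j).+1 =>
      bcg_rho j *m invmx (bcg_gamma j') *m invmx (phi j') *m invmx (bcg_rho j')
  end.

(* Meaningful for k >= 1. *)
Fixpoint qr_eta (k : nat) : 'M[R]_m :=
  match k with
  | 0 => 0
  | j.+1 => if j is 0 then (theta 0)^T else (qr (beta_tilde j.+1 *m qr_eta j)).1
  end.

End OLBCG.

(* Main.v *)
Require Import Defs.
From HB Require Import structures.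
From mathcomp Require Import all_boot all_order all_algebra.
From mathcomp Require Import ring.
From mathcomp Require Import boolp classical_sets reals.

Set Implicit Arguments.
Unset Strict Implicit.
Unset Printing Implicit Defensive.

Import Order.TTheory GRing.Theory Num.Theory.
Local Open Scope ring_scope.

(* As long as dim K_k(A, r_0) = k m, the residual r_j and the direction p_j
   equal A^j r_0 C modulo lower powers of A, with C nonsingular; hence they have
   full column rank, no CG step breaks down, and the usual induction gives
   mutually orthogonal residual blocks and A-conjugate direction blocks.
   Eliminating the directions, the normalized blocks
   q_j = (-1)^j r_j rho_j^-1 satisfy a symmetric three-term recurrence with
   coefficients talpha and tbeta. Uniqueness of the QR factorization then
   yields v_{j+1} = q_j eta_{j+1} by induction on j, and the Lanczos
   coefficients are those of the recurrence conjugated by the eta's. *)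

(** * Full column rank and positive definiteness *)

Section FullRank.
Variable R : realType.

Definition full_col_rank (n m : nat) (B : 'M[R]_(n, m)) : Prop :=
  forall x : 'cV[R]_m, B *m x = 0 -> x = 0.

Lemma full_col_rank_unitmx (m : nat) (B : 'M[R]_m) :
  full_col_rank B -> B \in unitmx.
Proof.
move=> Binj; rewrite -unitmx_tr -row_free_unit -kermx_eq0.
apply/eqP/row_matrixP => i; rewrite row0; apply: trmx_inj; rewrite trmx0.
apply: Binj; apply: trmx_inj; rewrite trmx_mul trmxK trmx0.
by rewrite -row_mul mulmx_ker row0.
Qed.

Lemma unitmx_full_col_rank (m : nat) (B : 'M[R]_m) :
  B \in unitmx -> full_col_rank B.
Proof. by move=> Bu x Bx; rewrite -[x](mulKmx Bu) Bx mulmx0. Qed.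

Lemma posdef1 (n : nat) : posdef (1%:M : 'M[R]_n).
Proof.
move=> x xN0; rewrite mulmx1 mxE lt_def sumr_ge0 ?andbT; last first.
  by move=> i _; rewrite mxE -expr2 sqr_ge0.
apply: contra xN0 => /eqP /psumr_eq0P sum0; apply/eqP/colP => i; rewrite mxE.
have /eqP : x^T 0 i * x i 0 = 0.
  by apply: sum0 => // j _; rewrite mxE -expr2 sqr_ge0.
by rewrite mxE mulf_eq0 orbb => /eqP.
Qed.

Lemma posdef_congr (n m : nat) (A : 'M[R]_n) (B : 'M[R]_(n, m)) :
  posdef A -> full_col_rank B -> posdef (B^T *m A *m B).
Proof.
move=> Apos Binj x xN0; rewrite !mulmxA -trmx_mul -mulmxA.
by apply: Apos; apply: contra xN0 => /eqP/Binj ->.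
Qed.

Lemma posdef_gram (n m : nat) (B : 'M[R]_(n, m)) :
  full_col_rank B -> posdef (B^T *m B).
Proof.
by move=> /(posdef_congr (@posdef1 n)); rewrite mulmx1.
Qed.

Lemma posdef_unitmx (m : nat) (G : 'M[R]_m) : posdef G -> G \in unitmx.
Proof.
move=> Gpos; apply: full_col_rank_unitmx => x Gx0; apply/eqP.
by apply/negPn/negP => /Gpos; rewrite -mulmxA Gx0 mulmx0 mxE ltxx.
Qed.

End FullRank.

(** * Existence and uniqueness of Cholesky and QR factors *)

Section CholeskyQR.
Variable R : realType.

Lemma upper_pos_block (m : nat) (S : 'M[R]_(1 + m)) : upper_pos S ->
  [/\ dlsubmx S = 0, 0 < ulsubmx S 0 0 & upper_pos (drsubmx S)].
Proof.
move=> [S0 Spos]; split; last split.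
- by apply/matrixP=> i j; rewrite !mxE S0 //= ord1.
- by rewrite !mxE.
- by move=> i j ltji; rewrite !mxE S0 //= ltn_add2l.
- by move=> i; rewrite !mxE.
Qed.

Lemma block_upper_pos (m : nat) (s : R) (u : 'rV[R]_m) (S : 'M[R]_m) :
  0 < s -> upper_pos S -> upper_pos (block_mx s%:M u 0 S).
Proof.
move=> s_gt0 [S0 Spos]; split=> [i j | i].
  case: (splitP i) => i' Ei; case: (splitP j) => j' Ej; rewrite Ei Ej.
  - by rewrite !ord1.
  - by rewrite ord1.
  - have -> : i = rshift 1 i' by apply: val_inj.
    have -> : j = lshift m j' by apply: val_inj.
    by rewrite block_mxEdl mxE.
  - have -> : i = rshift 1 i' by apply: val_inj.
    have -> : j = rshift 1 j' by apply: val_inj.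
    by rewrite block_mxEdr ltn_add2l => /S0.
case: (splitP i) => i' Ei.
  have -> : i = lshift m i' by apply: val_inj.
  by rewrite block_mxEul ord1 mxE eqxx.
have -> : i = rshift 1 i' by apply: val_inj.
by rewrite block_mxEdr.
Qed.

(** Induction by bordering: the corner is a positive square root, dividing by it gives the rest of
    the first row, and cancelling that row's contribution leaves the same problem for the trailing
    block. *)
Lemma cholesky_uniq (m : nat) (S S' : 'M[R]_m) :
  upper_pos S -> upper_pos S' -> S^T *m S = S'^T *m S' -> S = S'.
Proof.
elim: m S S' => [|m IHm] S S'; first by rewrite (flatmx0 S) (flatmx0 S').
rewrite -[m.+1]/(1 + m)%N in S S' *.
move=> /upper_pos_block[Sdl Sul Sdr] /upper_pos_block[Sdl' Sul' Sdr'].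
rewrite -[S]submxK -[S']submxK Sdl Sdl' !tr_block_mx !mulmx_block.
rewrite !trmx0 !mul0mx !mulmx0 !addr0 => /eq_block_mx[Eul Eur _ Edr].
have {}Eul : ulsubmx S = ulsubmx S'.
  move: Sul Sul' Eul; move: (ulsubmx S) (ulsubmx S') => a a' a0 a0'.
  move=> /matrixP/(_ 0 0); rewrite !mxE !big_ord1 !mxE -!expr2 => /eqP.
  by rewrite eqrXn2 ?ltW // => /eqP Ea; apply/matrixP=> i j; rewrite !ord1.
have {}Eur : ursubmx S = ursubmx S'.
  move: Sul' Eur; rewrite Eul.
  move: (ulsubmx S') (ursubmx S) (ursubmx S') => a u u' a0.
  move=> /matrixP Eu; apply/matrixP => i j; move: (Eu 0 j).
  rewrite !ord1 !mxE !big_ord1 !mxE; apply: mulfI; exact: lt0r_neq0.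
rewrite Eul Eur (IHm _ _ Sdr Sdr') //.
by move: Edr; rewrite Eur => /addrI.
Qed.

(** Induction through the Schur complement of the corner [a], whose Cholesky factor is the trailing
    block of the factor sought. *)
Lemma cholesky_exists (m : nat) (G : 'M[R]_m) :
  G^T = G -> posdef G -> exists S, upper_pos S /\ S^T *m S = G.
Proof.
elim: m G => [|m IHm] G Gsym Gpos.
  by exists 0; split; [split; case | rewrite (flatmx0 G) flatmx0].
rewrite -[m.+1]/(1 + m)%N in G Gsym Gpos *.
have Edl : dlsubmx G = (ursubmx G)^T by rewrite trmx_ursub Gsym.
have Edr : (drsubmx G)^T = drsubmx G by rewrite trmx_drsub Gsym.
set a := ulsubmx G 0 0; set c := ursubmx G; set D := drsubmx G.
have Eul : ulsubmx G = a%:M by rewrite [LHS]mx11_scalar.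
have EG : G = block_mx a%:M c c^T D by rewrite -Eul -Edl submxK.
have quad (x : 'M[R]_1) (y : 'cV[R]_m) :
    (col_mx x y)^T *m G *m col_mx x y =
    a *: (x^T *m x) + x^T *m c *m y + (y^T *m c^T *m x + y^T *m D *m y).
  rewrite EG tr_col_mx mul_row_block mul_row_col !mulmxDl.
  by rewrite mul_mx_scalar -scalemxAl addrACA.
have a_gt0 : 0 < a.
  have := Gpos (col_mx 1%:M 0); rewrite quad.
  rewrite trmx1 trmx0 !mulmx0 !mul0mx !addr0 mulmx1 !mxE eqxx mulr1; apply.
  apply/negP; rewrite col_mx_eq0 => /andP[/eqP/matrixP/(_ 0 0)].
  by rewrite !mxE eqxx => /eqP; rewrite oner_eq0.
pose D' := D - a^-1 *: (c^T *m c).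
have [||S [Sup ES]] := IHm D'.
- by rewrite /D' linearB linearZ /= trmx_mul trmxK Edr.
- move=> y yN0.
  (* For fixed [y] this first coordinate minimizes the quadratic form of [G]; the minimum is the
     form of the Schur complement at [y]. *)
  have := Gpos (col_mx (- a^-1 *: (c *m y)) y); rewrite quad.
  have -> : D' = D - a^-1 *: (c^T *m c) by [].
  set x := _ *: _.
  have xT : x^T = - a^-1 *: (y^T *m c^T) by rewrite linearZ /= trmx_mul.
  have -> : a *: (x^T *m x) + x^T *m c *m y + (y^T *m c^T *m x + y^T *m D *m y)
      = y^T *m (D - a^-1 *: (c^T *m c)) *m y.
    rewrite xT /x mulmxBr mulmxBl; do 3!rewrite -?scalemxAl -?scalemxAr ?mulmxA.
    rewrite !scalerA !mulrN divff ?gt_eqF // mulN1r opprK scaleNr subrr.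
    by rewrite add0r addrC.
  by apply; rewrite col_mx_eq0 negb_and yN0 orbT.
pose s := Num.sqrt a.
have s_gt0 : 0 < s by rewrite sqrtr_gt0.
have ss : s * s = a by rewrite -expr2 sqr_sqrtr ?ltW.
exists (block_mx s%:M (s^-1 *: c) 0 S); split.
  exact: block_upper_pos.
rewrite tr_block_mx mulmx_block tr_scalar_mx trmx0 !mul0mx !mulmx0 !addr0 ES EG.
have sN0 : s != 0 by rewrite gt_eqF.
congr block_mx.
- by rewrite -scalar_mxM ss.
- by rewrite mul_scalar_mx scalerA divff ?scale1r.
- by rewrite linearZ /= mul_mx_scalar scalerA divff ?scale1r.
- rewrite [(_ *: c)^T]linearZ /= -scalemxAl -scalemxAr scalerA -invfM ss.
  by rewrite /D' addrC subrK.
Qed.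

Lemma upper_pos_unitmx (m : nat) (S : 'M[R]_m) : upper_pos S -> S \in unitmx.
Proof.
move=> [S0 Spos]; rewrite -unitmx_tr unitmxE det_trig.
  by rewrite unitfE; apply/prodf_neq0 => i _; rewrite mxE gt_eqF.
by apply/is_trig_mxP => i j ltij; rewrite mxE S0.
Qed.

Lemma cholP (n m : nat) (B : 'M[R]_(n, m)) : full_col_rank B ->
  upper_pos (chol (B^T *m B)) /\
  (chol (B^T *m B))^T *m chol (B^T *m B) = B^T *m B.
Proof.
move=> Bf; apply: (@xgetPex _ 0 (fun S => upper_pos S /\ S^T *m S = _)).
apply: cholesky_exists; last exact: posdef_gram.
by rewrite trmx_mul trmxK.
Qed.

(** If [S] is the Cholesky factor of the Gram matrix of [B], then [B *m invmx S] has orthonormal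
    columns. *)
Lemma qr_full_col_rank (n m : nat) (B : 'M[R]_(n, m)) :
  full_col_rank B -> is_qr B (qr B).1 (qr B).2.
Proof.
move=> Bf; rewrite /qr.
apply: (@xgetPex _ _ (fun QS : _ * _ => is_qr B QS.1 QS.2)).
have [Sup ES] := cholP Bf; set S := chol _ in Sup ES.
have Su := upper_pos_unitmx Sup.
exists (B *m invmx S, S); split=> //=; first by rewrite mulmxKV.
rewrite trmx_mul trmx_inv !mulmxA -[_ *m B^T *m B]mulmxA -ES mulmxA.
rewrite mulVmx ?unitmx_tr //.
by rewrite mul1mx mulmxV.
Qed.

(** The triangular factor is the Cholesky factor of [B^T *m B], hence unique; being invertible, it
    determines the orthonormal factor. *)
Lemma is_qr_uniq (n m : nat) (B Q Q' : 'M[R]_(n, m)) (S S' : 'M[R]_m) :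
  is_qr B Q S -> is_qr B Q' S' -> Q = Q' /\ S = S'.
Proof.
move=> [BQ Qo Sup] [BQ' Qo' Sup'].
have ES : S = S'.
  apply: cholesky_uniq => //.
  have gram (P : 'M[R]_(n, m)) (V : 'M[R]_m) :
      B = P *m V -> P^T *m P = 1%:M -> V^T *m V = B^T *m B.
    by move=> -> Po; rewrite trmx_mul -!mulmxA [P^T *m _]mulmxA Po mul1mx.
  by rewrite (gram Q) ?(gram Q').
split=> //; rewrite -[Q](mulmxK (upper_pos_unitmx Sup)) -BQ BQ' ES.
by rewrite mulmxK ?upper_pos_unitmx.
Qed.

Lemma qrP (n m : nat) (B Q : 'M[R]_(n, m)) (S : 'M[R]_m) :
  is_qr B Q S -> qr B = (Q, S).
Proof.
move=> BQS; have : is_qr B (qr B).1 (qr B).2.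
  by apply: (@xgetPex _ _ (fun QS : _ * _ => is_qr B QS.1 QS.2)); exists (Q, S).
by case: (qr B) => [Q' S'] /(is_qr_uniq BQS)[-> ->].
Qed.

(** Reduces the factorization of a tall Lanczos block to that of the small matrix which defines the
    next [e]. *)
Lemma is_qr_mull (n p m : nat) (P : 'M[R]_(n, p)) (B Q : 'M[R]_(p, m))
    (S : 'M[R]_m) :
  P^T *m P = 1%:M -> is_qr B Q S -> is_qr (P *m B) (P *m Q) S.
Proof.
move=> Po [-> Qo Sup]; split=> //; first by rewrite mulmxA.
by rewrite trmx_mul -mulmxA [P^T *m _]mulmxA Po mul1mx.
Qed.

End CholeskyQR.

(** * Krylov combinations and their leading coefficients *)

Section Krylov.
Variables (R : realType) (n m : nat) (A : 'M[R]_n) (v : 'M[R]_(n, m)).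

(** Column [i] of [Y] holds the coefficients of the block [A ^+ i *m v], so that the domain has
    dimension [m * k]. *)
Definition krylov_eval (k : nat) (Y : 'M[R]_(m, k)) : 'cV[R]_n :=
  \sum_(i < k) A ^+ i *m v *m col i Y.

Fact krylov_eval_linear k : linear (@krylov_eval k).
Proof.
move=> a Y Z; rewrite /krylov_eval scaler_sumr -big_split /=.
by apply: eq_bigr => i _; rewrite linearD linearZ /= mulmxDr -scalemxAr.
Qed.

HB.instance Definition _ k := GRing.isLinear.Build R 'M[R]_(m, k) 'cV[R]_n _
  (@krylov_eval k) (@krylov_eval_linear k).

(** The image contains the Krylov space, whose dimension is that of the whole domain; by
    rank-nullity the kernel is trivial. *)
Lemma krylov_eval_inj k (Y : 'M[R]_(m, k)) :
  \dim (krylov k A v) = (k * m)%N -> krylov_eval Y = 0 -> Y = 0.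
Proof.
move=> dimK Y0.
pose f : 'Hom('M[R]_(m, k), 'cV[R]_n) := linfun (@krylov_eval k).
have subK : (krylov k A v <= limg f)%VS.
  apply/span_subvP => _ /allpairsP[[i j] [_ _ ->]] /=.
  apply/memv_imgP; exists (delta_mx j i); first exact: memvf.
  rewrite lfunE /= /krylov_eval (bigD1 i) //= big1 ?addr0 => [|i' /negPf ni'].
    by rewrite !colE mul_delta_mx.
  by rewrite colE mul_delta_mx_cond eq_sym ni' mulr0n mulmx0.
have /eqP : \dim (lker f) = 0%N.
  have := limg_ker_dim f fullv; rewrite capfv dimvf /dim /= => dimE.
  have := dimvS subK; rewrite dimK mulnC => lekm.
  by apply/eqP; rewrite -leqn0 -(leq_add2r (m * k)) add0n -{2}dimE leq_add2l.
rewrite dimv_eq0 => /eqP kerf.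
by apply/eqP; rewrite -memv0 -kerf memv_ker lfunE /= Y0.
Qed.

(** Block analogue of a polynomial in [A] of degree less than [j] applied to [v], with matrix
    coefficients on the right. *)
Definition krylov_below (j : nat) (B : 'M[R]_(n, m)) : Prop :=
  exists c : nat -> 'M[R]_m, B = \sum_(i < j) A ^+ i *m v *m c i.

(** Block analogue of degree exactly [j]: a nonsingular leading coefficient replaces a nonzero
    one. *)
Definition krylov_lead (j : nat) (B : 'M[R]_(n, m)) : Prop :=
  exists2 C : 'M[R]_m, C \in unitmx & krylov_below j (B - A ^+ j *m v *m C).

Lemma krylov_belowD j B C :
  krylov_below j B -> krylov_below j C -> krylov_below j (B + C).
Proof.
move=> [c ->] [d ->]; exists (fun i => c i + d i); rewrite -big_split.
by apply: eq_bigr => i _; rewrite mulmxDr.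
Qed.

Lemma krylov_belowMr j B C : krylov_below j B -> krylov_below j (B *m C).
Proof.
move=> [c ->]; exists (fun i => c i *m C); rewrite mulmx_suml.
by apply: eq_bigr => i _; rewrite mulmxA.
Qed.

Lemma krylov_belowMl j B : krylov_below j B -> krylov_below j.+1 (A *m B).
Proof.
move=> [c ->]; exists (fun i => if i is i'.+1 then c i' else 0).
rewrite big_ord_recl mulmx0 add0r mulmx_sumr.
by apply: eq_bigr => i _; rewrite lift0 exprS !mulmxA.
Qed.

Lemma krylov_lead_below j B : krylov_lead j B -> krylov_below j.+1 B.
Proof.
move=> [C _ [c E]]; exists (fun i => if (i < j)%N then c i else C).
rewrite big_ord_recr /= ltnn -[LHS](subrK (A ^+ j *m v *m C)) E; congr (_ + _).
by apply: eq_bigr => i _; rewrite ltn_ord.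
Qed.

Lemma krylov_leadD j B C :
  krylov_lead j B -> krylov_below j C -> krylov_lead j (B + C).
Proof.
by move=> [D Du BD] Cb; exists D; rewrite // addrAC; exact: krylov_belowD.
Qed.

Lemma krylov_leadMr j B C :
  C \in unitmx -> krylov_lead j B -> krylov_lead j (B *m C).
Proof.
move=> Cu [D Du BD]; exists (D *m C); first by rewrite unitmx_mul Du.
by rewrite mulmxA -mulmxBl; exact: krylov_belowMr.
Qed.

Lemma krylov_leadMl j B : krylov_lead j B -> krylov_lead j.+1 (A *m B).
Proof.
move=> [D Du BD]; exists D => //.
by rewrite exprS -!mulmxA -mulmxBr !mulmxA; exact: krylov_belowMl.
Qed.

Lemma krylov_lead_start : krylov_lead 0 v.
Proof.
exists 1%:M; first exact: unitmx1.
by exists (fun=> 0); rewrite big_ord0 expr0 mul1mx mulmx1 subrr.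
Qed.

(** A relation [B *m x = 0] is a relation between Krylov blocks in which [A ^+ j *m v] has
    coefficient [C *m x]; independence makes that vanish. *)
Lemma krylov_lead_full_col_rank k j B :
  \dim (krylov k A v) = (k * m)%N -> (j < k)%N -> krylov_lead j B ->
  full_col_rank B.
Proof.
move=> dimK ltjk [C Cu [c BE]] x Bx0.
pose Y : 'M[R]_(m, k) := \matrix_(a, i)
  ((if (i < j)%N then c i *m x else if i == j :> nat then C *m x else 0) a 0).
have colY (i : 'I_k) : col i Y =
    if (i < j)%N then c i *m x else if i == j :> nat then C *m x else 0.
  by apply/colP => a; rewrite !mxE.
have evY : krylov_eval Y = 0.
  rewrite -Bx0 -[B](subrK (A ^+ j *m v *m C)) BE mulmxDl mulmx_suml.
  pose F i := A ^+ i *m v *m (if (i < j)%N then c i else C) *m x.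
  (* The columns of [Y] beyond index [j] are zero. *)
  transitivity (\sum_(i < j.+1) F i).
    rewrite (big_ord_widen k F ltjk) big_mkcond; apply: eq_bigr => i _.
    by rewrite colY /F ltnS -!mulmxA; case: ltngtP; rewrite ?mulmx0.
  rewrite big_ord_recr /F /= ltnn; congr (_ + _).
  by apply: eq_bigr => i _; rewrite ltn_ord.
have := colY (Ordinal ltjk); rewrite /= ltnn eqxx (krylov_eval_inj dimK evY).
by rewrite col0 => /esym /(unitmx_full_col_rank Cu).
Qed.

End Krylov.

(** * Orthogonality and conjugacy in block CG *)

Section BlockCG.
Variables (R : realType) (n m : nat) (A : 'M[R]_n) (b x0 : 'M[R]_(n, m)).
Variables (phi : nat -> 'M[R]_m) (k : nat).
Hypotheses (A_sym : A^T = A) (A_posdef : posdef A).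
Hypothesis phi_unit : forall j, (j < k)%N -> phi j \in unitmx.
Hypothesis dim_krylov : \dim (krylov k A (b - A *m x0)) = (k * m)%N.

Local Notation r := (bcg_r A b x0 phi).
Local Notation p := (bcg_p A b x0 phi).
Local Notation gamma := (bcg_gamma A b x0 phi).
Local Notation delta := (bcg_delta A b x0 phi).
Local Notation lead := (krylov_lead A (b - A *m x0)).

(** The two [lead] clauses make the Gram and energy matrices invertible for [j < k]; the clause on
    [(p i)^T *m r j] is the one from which residual orthogonality is propagated. *)
Definition bcg_invariant (j : nat) : Prop :=
  [/\ lead j (r j), lead j (p j),
      forall i, (i < j)%N -> (r i)^T *m r j = 0,
      forall i, (i < j)%N -> (p i)^T *m r j = 0 &
      forall i, (i < j)%N -> (p i)^T *m A *m p j = 0].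

Lemma bcg_gram_unitmx j : (j < k)%N -> bcg_invariant j ->
  (r j)^T *m r j \in unitmx.
Proof.
move=> ltjk [rl _ _ _ _]; apply/posdef_unitmx/posdef_gram.
exact: krylov_lead_full_col_rank dim_krylov ltjk rl.
Qed.

Lemma bcg_energy_unitmx j : (j < k)%N -> bcg_invariant j ->
  (p j)^T *m A *m p j \in unitmx.
Proof.
move=> ltjk [_ pl _ _ _]; apply/posdef_unitmx/posdef_congr => //.
exact: krylov_lead_full_col_rank dim_krylov ltjk pl.
Qed.

Lemma bcg_gamma_unitmx j : (j < k)%N -> bcg_invariant j -> gamma j \in unitmx.
Proof.
move=> ltjk Ij; rewrite !unitmx_mul unitmx_inv unitmx_tr phi_unit //.
by rewrite bcg_energy_unitmx ?bcg_gram_unitmx.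
Qed.

Lemma bcg_energy_gamma j : (j < k)%N -> bcg_invariant j ->
  (p j)^T *m A *m p j *m gamma j = (phi j)^T *m ((r j)^T *m r j).
Proof.
move=> ltjk Ij; rewrite /bcg_gamma /gamma_of -[invmx _ *m _ *m _]mulmxA.
by rewrite mulKVmx // bcg_energy_unitmx.
Qed.

Lemma bcg_p_r_diag j : (j < k)%N -> bcg_invariant j ->
  (p j)^T *m r j = (phi j)^T *m ((r j)^T *m r j).
Proof.
case: j => [|j] ltjk [_ _ _ pr _]; first by rewrite trmx_mul mulmxA.
rewrite bcg_p_step trmx_mul [(_ + _)^T]linearD /= trmx_mul -mulmxA mulmxDl.
by rewrite -[_ *m (p j)^T *m _]mulmxA pr // mulmx0 addr0.
Qed.

Lemma bcg_A_p j : (j < k)%N -> bcg_invariant j ->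
  A *m p j = (r j - r j.+1) *m invmx (gamma j).
Proof.
move=> ltjk Ij; rewrite bcg_r_step opprB addrC subrK mulmxK //.
exact: bcg_gamma_unitmx.
Qed.

Lemma bcg_r0E : (0 < k)%N -> r 0 = p 0 *m invmx (phi 0).
Proof. by move=> k0; rewrite [p 0]/(r 0 *m phi 0) mulmxK ?phi_unit. Qed.

Lemma bcg_rSE j : (j.+1 < k)%N ->
  r j.+1 = p j.+1 *m invmx (phi j.+1) - p j *m delta j.+1.
Proof. by move=> ltjk; rewrite bcg_p_step mulmxK ?phi_unit // addrK. Qed.

(** For [i = j] this is the defining property of [gamma j]; for [i < j] both terms of the residual
    update vanish by the invariant. *)
Lemma bcg_p_r j : (j < k)%N -> bcg_invariant j ->
  forall i, (i <= j)%N -> (p i)^T *m r j.+1 = 0.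
Proof.
move=> ltjk Ij i; rewrite bcg_r_step mulmxBr leq_eqVlt.
rewrite (mulmxA _ (A *m p j) (gamma j)) (mulmxA _ A (p j)).
case/predU1P=> [-> | ltij].
  by rewrite bcg_energy_gamma // bcg_p_r_diag // subrr.
by case: Ij => [_ _ _ -> // ->//]; rewrite mul0mx subrr.
Qed.

(** Each [r i] is a combination of [p i] and [p i.-1], so orthogonality to the directions
    suffices. *)
Lemma bcg_r_r j : (j < k)%N -> bcg_invariant j ->
  forall i, (i <= j)%N -> (r i)^T *m r j.+1 = 0.
Proof.
move=> ltjk Ij [|i] leij.
  by rewrite bcg_r0E ?(leq_trans _ ltjk) // trmx_mul -mulmxA bcg_p_r // mulmx0.
rewrite bcg_rSE ?(leq_ltn_trans leij) // [(_ - _)^T]linearB /= !trmx_mul.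
by rewrite mulmxBl -!mulmxA !bcg_p_r ?(ltnW leij) // !mulmx0 subrr.
Qed.

(** The choice of [delta] in the form needed for conjugacy of consecutive directions. *)
Lemma bcg_energy_delta j : (j < k)%N -> bcg_invariant j ->
  (invmx (gamma j))^T *m ((r j.+1)^T *m r j.+1) =
  (p j)^T *m A *m p j *m delta j.+1.
Proof.
move=> ltjk Ij; have gu := bcg_gamma_unitmx ltjk Ij.
have Nu := bcg_gram_unitmx ltjk Ij.
rewrite /bcg_delta /delta_of /= !mulmxA; congr (_ *m _ *m _).
rewrite trmx_inv; apply: (can_inj (mulKmx (_ : (gamma j)^T \in unitmx))).
  by rewrite unitmx_tr.
rewrite mulmxV ?unitmx_tr // !mulmxA.
(* Transpose of [bcg_energy_gamma]; this is where symmetry of [A] enters. *)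
have -> : (gamma j)^T *m (p j)^T *m A *m p j = (r j)^T *m r j *m phi j.
  transitivity (((p j)^T *m A *m p j *m gamma j)^T).
    rewrite (trmx_mul _ (gamma j)) (trmx_mul _ (p j)) (trmx_mul _ A) trmxK.
    by rewrite A_sym !mulmxA.
  by rewrite bcg_energy_gamma // !trmx_mul !trmxK.
by rewrite mulmxK ?phi_unit // mulmxV.
Qed.

(** [A *m p i] is a combination of [r i] and [r i.+1]. Both are orthogonal to [r j.+1] if [i < j];
    if [i = j] the surviving term is cancelled by [delta]. Inverting [gamma i] calls for the
    invariant at every [i <= j]. *)
Lemma bcg_p_p j : (j < k)%N -> (forall i, (i <= j)%N -> bcg_invariant i) ->
  forall i, (i <= j)%N -> (p i)^T *m A *m p j.+1 = 0.
Proof.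
move=> ltjk I i leij; have ltik := leq_ltn_trans leij ltjk.
have Ij := I j (leqnn j).
have pAr : (p i)^T *m A *m r j.+1 =
    (invmx (gamma i))^T *m ((r i)^T *m r j.+1 - (r i.+1)^T *m r j.+1).
  have -> : (p i)^T *m A = (A *m p i)^T by rewrite trmx_mul A_sym.
  rewrite (bcg_A_p ltik (I i leij)) (trmx_mul _ (invmx _)).
  by rewrite [(_ - _)^T]linearB /= -mulmxA mulmxBl.
rewrite bcg_p_step mulmxA mulmxDr pAr (bcg_r_r ltjk Ij leij) sub0r.
rewrite (mulmxA _ (p j)).
move: leij; rewrite leq_eqVlt => /predU1P[Eij | ltij].
  by rewrite Eij mulmxN bcg_energy_delta // addNr mul0mx.
rewrite (bcg_r_r ltjk Ij ltij) oppr0 mulmx0 add0r.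
by case: Ij => _ _ _ _ -> //; rewrite !mul0mx.
Qed.

Lemma bcg_invariantP j : (j < k)%N -> bcg_invariant j.
Proof.
(* Strong induction, since [bcg_p_p] uses all earlier invariants. *)
suff: (j < k)%N -> forall i, (i <= j)%N -> bcg_invariant i.
  by move=> I /I; apply.
elim: j => [|j IHj] ltjk i.
  rewrite leqn0 => /eqP->; split=> //; first exact: krylov_lead_start.
  by apply: krylov_leadMr; [exact: phi_unit | exact: krylov_lead_start].
have {}IHj := IHj (ltnW ltjk); rewrite leq_eqVlt => /predU1P[-> | /IHj//].
have Ij := IHj j (leqnn j); have [rl pl _ _ _] := Ij.
have rS : lead j.+1 (r j.+1).
  (* The leading term comes from [- A *m p j *m gamma j]; [r j] has only lower powers. *)
  rewrite bcg_r_step [r j - _]addrC; apply: krylov_leadD (krylov_lead_below rl).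
  rewrite -(mulmxN (A *m p j)); apply: krylov_leadMr; last exact: krylov_leadMl.
  by rewrite -scaleN1r unitmxZ ?unitrN1 // bcg_gamma_unitmx // ltnW.
split=> //; try by [apply: bcg_r_r => //; exact: ltnW
                   | apply: bcg_p_r => //; exact: ltnW
                   | apply: bcg_p_p => //; exact: ltnW].
rewrite bcg_p_step; apply: krylov_leadMr; first exact: phi_unit.
apply: krylov_leadD => //; apply: krylov_belowMr; exact: krylov_lead_below.
Qed.

End BlockCG.

(** * Lanczos coefficients obtained from another three-term recurrence *)

Section LanczosSimilarity.
Variables (R : realType) (n m : nat) (A : 'M[R]_n) (v : 'M[R]_(n, m)).
Variables (k : nat) (q : nat -> 'M[R]_(n, m)) (ta tb e : nat -> 'M[R]_m).
Variable S0 : 'M[R]_m.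

(* [q] is numbered from 0, whereas [ta], [tb], [e] and the Lanczos blocks are
   numbered from 1: [q j] corresponds to the Lanczos block of index [j.+1]. *)
Let c (j : nat) : 'M[R]_(n, m) := if j is i.+1 then q i *m (tb j.+1)^T else 0.

Hypothesis q_orth : forall j, (j < k)%N -> (q j)^T *m q j = 1%:M.
Hypothesis q_diag : forall j, (j < k)%N ->
  (q j)^T *m (A *m q j - c j) = ta j.+1.
Hypothesis q_rec : forall j, (j.+1 < k)%N ->
  A *m q j - c j - q j *m ta j.+1 = q j.+1 *m tb j.+2.
Hypothesis tb_unit : forall j, (j.+1 < k)%N -> tb j.+2 \in unitmx.
Hypothesis e1_orth : (e 1)^T *m e 1 = 1%:M.
Hypothesis v_qr : is_qr v (q 0 *m e 1) S0.
Hypothesis e_rec : forall j, (j.+1 < k)%N ->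
  e j.+2 = (qr (tb j.+2 *m e j.+1)).1.

Lemma lanczos_alpha_similar j : (j < k)%N ->
  lanczos_v A v j.+1 = q j *m e j.+1 ->
  lanczos_v A v j *m (lanczos_beta A v j.+1)^T = c j *m e j.+1 ->
  lanczos_alpha A v j.+1 = (e j.+1)^T *m ta j.+1 *m e j.+1.
Proof.
move=> ltjk Ev Ec; rewrite /lanczos_alpha /= Ec Ev mulmxA -mulmxBl.
by rewrite trmx_mul -!mulmxA [(q j)^T *m _]mulmxA q_diag.
Qed.

(** The block factored by Lanczos equals [q j.+1 *m (tb j.+2 *m e j.+1)], so uniqueness of QR gives
    the next block and coefficient. The third clause carries along the term subtracted at the next
    step; both its sides are zero at [j = 0]. *)
Lemma lanczos_similar j : (j < k)%N ->
  [/\ lanczos_v A v j.+1 = q j *m e j.+1, (e j.+1)^T *m e j.+1 = 1%:M,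
      lanczos_v A v j *m (lanczos_beta A v j.+1)^T = c j *m e j.+1 &
      (0 < j)%N -> is_qr (tb j.+1 *m e j) (e j.+1) (lanczos_beta A v j.+1)].
Proof.
elim: j => [|j IHj] ltjk.
  have := lanczos_init A v; rewrite (qrP v_qr) => -[Ev _].
  by split; rewrite // ?lanczos_v0 ?mul0mx.
have {IHj} [Ev eo Ec _] := IHj (ltnW ltjk).
have Ea := lanczos_alpha_similar (ltnW ltjk) Ev Ec.
have eeT := mulmx1C eo.
(* Invertibility of [tb j.+2] and [e j.+1] ensures that [qr] does not return its default value. *)
have [S Bqr] : exists S, is_qr (tb j.+2 *m e j.+1) (e j.+2) S.
  exists (qr (tb j.+2 *m e j.+1)).2; rewrite e_rec //.
  apply/qr_full_col_rank/unitmx_full_col_rank.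
  by rewrite unitmx_mul tb_unit // (mulmx1_unit eo).2.
have := lanczos_step A v (ltn0Sn j); rewrite -pred_Sn Ea Ev Ec.
have -> : A *m (q j *m e j.+1) - c j *m e j.+1
    - q j *m e j.+1 *m ((e j.+1)^T *m ta j.+1 *m e j.+1)
    = q j.+1 *m (tb j.+2 *m e j.+1).
  rewrite [RHS]mulmxA -q_rec // !mulmxBl !mulmxA; congr (_ - _ *m _ *m _).
  by rewrite -mulmxA eeT mulmx1.
rewrite (qrP (is_qr_mull (q_orth ltjk) Bqr)) => -[EvS Eb].
rewrite -Eb -EvS; have [BE eSo _] := Bqr; split=> //.
have -> : S = (e j.+2)^T *m (tb j.+2 *m e j.+1) by rewrite BE mulmxA eSo mul1mx.
by rewrite !trmx_mul trmxK !mulmxA -(mulmxA (q j)) eeT mulmx1.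
Qed.

Lemma lanczos_beta_similar j : (0 < j < k)%N ->
  lanczos_beta A v j.+1 = (e j.+1)^T *m tb j.+1 *m e j.
Proof.
move=> /andP[j0 ltjk]; have [_ eo _ /(_ j0)[BE _ _]] := lanczos_similar ltjk.
by rewrite -mulmxA BE mulmxA eo mul1mx.
Qed.

(** Conjugation by a block diagonal matrix acts block by block. *)
Lemma block_tridiag_similar :
  block_tridiag k (lanczos_alpha A v) (lanczos_beta A v) =
  (block_diag k e)^T *m block_tridiag k ta tb *m block_diag k e.
Proof.
rewrite /block_tridiag /block_diag tr_mxdiag mul_mxdiag_mxblock.
rewrite mul_mxblock_mxdiag; apply: eq_mxblock => i j.
have beta_ij (i' j' : 'I_k) : i' = j'.+1 :> nat ->
    lanczos_beta A v i'.+1 = (e i'.+1)^T *m tb i'.+1 *m e j'.+1.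
  by move=> Eij; rewrite -Eij lanczos_beta_similar // ltn_ord Eij.
case: eqP => [-> | _].
  have [? ? ? _] := lanczos_similar (ltn_ord j).
  exact: lanczos_alpha_similar.
case: eqP => [/beta_ij // | _].
case: eqP => [/beta_ij -> | _]; first by rewrite !trmx_mul trmxK mulmxA.
by rewrite mulmx0 mul0mx.
Qed.

End LanczosSimilarity.

(** * Three-term recurrence of the normalized residuals *)

Section NormalizedResiduals.
Variables (R : realType) (n m : nat) (A : 'M[R]_n) (b x0 : 'M[R]_(n, m)).
Variables (phi theta : nat -> 'M[R]_m) (k : nat).
Hypotheses (A_sym : A^T = A) (A_posdef : posdef A).
Hypothesis phi_unit : forall j, (j < k)%N -> phi j \in unitmx.
Hypothesis theta_orth : forall j, (j < k)%N -> orthogonal_mx (theta j).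
Hypothesis dim_krylov : \dim (krylov k A (b - A *m x0)) = (k * m)%N.

Local Notation r := (bcg_r A b x0 phi).
Local Notation p := (bcg_p A b x0 phi).
Local Notation gamma := (bcg_gamma A b x0 phi).
Local Notation delta := (bcg_delta A b x0 phi).
Local Notation rho := (bcg_rho A b x0 phi theta).
Local Notation ta := (alpha_tilde A b x0 phi theta).
Local Notation tb := (beta_tilde A b x0 phi theta).

Let inv j (ltjk : (j < k)%N) : bcg_invariant A b x0 phi j :=
  bcg_invariantP A_sym A_posdef phi_unit dim_krylov ltjk.

Let gamma_unit j (ltjk : (j < k)%N) : gamma j \in unitmx :=
  bcg_gamma_unitmx A_posdef phi_unit dim_krylov ltjk (inv ltjk).

(* The signs are those for which the subdiagonal coefficients of the
   three-term recurrence are the matrices [tb j] rather than [- tb j]. *)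
Definition normalized_residual (j : nat) : 'M[R]_(n, m) :=
  (-1) ^+ j *: (r j *m invmx (rho j)).
Local Notation q := normalized_residual.

Lemma bcg_sigmaP j : (j < k)%N ->
  upper_pos (bcg_sigma A b x0 phi j) /\
  (bcg_sigma A b x0 phi j)^T *m bcg_sigma A b x0 phi j = (r j)^T *m r j.
Proof.
move=> ltjk; apply: cholP; have [rl _ _ _ _] := inv ltjk.
exact: krylov_lead_full_col_rank dim_krylov ltjk rl.
Qed.

Lemma bcg_rho_gram j : (j < k)%N -> (rho j)^T *m rho j = (r j)^T *m r j.
Proof.
move=> ltjk; have [_ <-] := bcg_sigmaP ltjk; rewrite /bcg_rho trmx_mul trmxK.
by rewrite -mulmxA [theta j *m _]mulmxA (mulmx1C (theta_orth ltjk)) mul1mx.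
Qed.

Lemma bcg_rho_unitmx j : (j < k)%N -> rho j \in unitmx.
Proof.
move=> ltjk; have := bcg_gram_unitmx dim_krylov ltjk (inv ltjk).
by rewrite -bcg_rho_gram // unitmx_mul => /andP[].
Qed.

Lemma normalized_residual_orth j : (j < k)%N -> (q j)^T *m q j = 1%:M.
Proof.
move=> ltjk; have ru := bcg_rho_unitmx ltjk.
rewrite /q [(_ *: _)^T]linearZ /= -scalemxAl -scalemxAr scalerA -expr2.
rewrite sqrr_sign scale1r.
rewrite trmx_mul mulmxA -(mulmxA _ (r j)^T) -bcg_rho_gram // mulmxA mulmxK //.
by rewrite -trmx_mul mulmxV // trmx1.
Qed.

(** [bcg_energy_delta] with the energy matrix eliminated by means of [gamma] and the factor
    [(phi j)^T] cleared. *)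
Lemma bcg_gram_delta j : (j < k)%N ->
  (r j)^T *m r j *m (invmx (gamma j) *m delta j.+1) =
  invmx (phi j)^T *m (invmx (gamma j))^T *m ((r j.+1)^T *m r j.+1).
Proof.
move=> ltjk; rewrite -[RHS]mulmxA.
rewrite (bcg_energy_delta A_sym A_posdef phi_unit dim_krylov ltjk (inv ltjk)).
rewrite -[(p j)^T *m A *m p j](mulmxK (gamma_unit ltjk)).
rewrite (bcg_energy_gamma A_posdef dim_krylov ltjk (inv ltjk)).
by rewrite -!(mulmxA (phi j)^T) mulKmx ?unitmx_tr ?phi_unit // mulmxA.
Qed.

(** Symmetry of the recurrence: the right-hand side is the coefficient that eliminating the
    directions puts on the previous residual. Multiplying by [(rho j)^T] creates Gram matrices and
    reduces the claim to [bcg_gram_delta]. *)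
Lemma beta_tilde_tr j : (j.+1 < k)%N ->
  (tb j.+2)^T = rho j *m invmx (gamma j) *m delta j.+1 *m invmx (rho j.+1).
Proof.
move=> ltjk; have ltjk' := ltnW ltjk.
have ru := bcg_rho_unitmx ltjk'; have ru' := bcg_rho_unitmx ltjk.
apply: (can_inj (mulKmx (_ : (rho j)^T \in unitmx))).
  by rewrite unitmx_tr.
rewrite -(mulmxA (rho j)) -(mulmxA (rho j)) !(mulmxA (rho j)^T (rho j)).
rewrite bcg_rho_gram //.
rewrite (mulmxA ((r j)^T *m r j)) bcg_gram_delta // -bcg_rho_gram //.
rewrite (mulmxA _ (rho j.+1)^T) mulmxK //.
(* Generalizing stops [trmx_mul] from unfolding [rho] and [gamma], which are
   products themselves; likewise for [mulmxA] in the next proofs. *)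
rewrite /=; move: ru; move: (rho j) (rho j.+1) (gamma j) (phi j) => s s1 g f su.
rewrite !trmx_mul !trmx_inv mulKVmx ?unitmx_tr //.
by rewrite !mulmxA.
Qed.

Let c (j : nat) : 'M[R]_(n, m) := if j is i.+1 then q i *m (tb j.+1)^T else 0.

(** Write [r j] through directions and replace each [A *m p i] by a residual difference. The
    right-hand side avoids [q j.+1] so as to cover [j = k.-1], where [rho k] may be singular. *)
Lemma normalized_residual_rec j : (j < k)%N ->
  A *m q j - c j - q j *m ta j.+1 =
  (-1) ^+ j.+1 *: (r j.+1 *m invmx (gamma j) *m invmx (phi j) *m invmx (rho j)).
Proof.
case: j => [|j] ltjk; have ru := bcg_rho_unitmx ltjk.
  rewrite subr0 /q expr0 expr1 scale1r scaleN1r /=.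
  have -> : A *m (r 0 *m invmx (rho 0)) =
      (r 0 - r 1) *m invmx (gamma 0) *m invmx (phi 0) *m invmx (rho 0).
    rewrite -(bcg_A_p A_posdef phi_unit dim_krylov ltjk (inv ltjk)).
    by rewrite [in LHS](bcg_r0E _ _ _ phi_unit ltjk) !mulmxA.
  move: ru; move: (rho 0) (gamma 0) (phi 0) => s g f su.
  by rewrite !mulmxA mulmxKV // !mulmxBl addrAC subrr add0r.
have ltjk' := ltnW ltjk; have ru' := bcg_rho_unitmx ltjk'.
rewrite /c beta_tilde_tr // /q -scalemxAr -!scalemxAl.
have -> : A *m (r j.+1 *m invmx (rho j.+1)) =
    (r j.+1 - r j.+2) *m invmx (gamma j.+1) *m invmx (phi j.+1)
      *m invmx (rho j.+1)
    - (r j - r j.+1) *m invmx (gamma j) *m delta j.+1 *m invmx (rho j.+1).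
  rewrite -(bcg_A_p A_posdef phi_unit dim_krylov ltjk (inv ltjk)).
  rewrite -(bcg_A_p A_posdef phi_unit dim_krylov ltjk' (inv ltjk')).
  by rewrite (bcg_rSE _ _ _ phi_unit ltjk) mulmxA mulmxBr mulmxBl !mulmxA.
rewrite [ta _]/=; move: ru ru'; move: (rho j.+1) (rho j) (gamma j.+1) (gamma j).
move: (phi j.+1) (delta j.+1) (r j) (r j.+1) (r j.+2).
move=> f d u u1 u2 s1 s g1 g su1 su.
rewrite mulmxDr !mulmxA !mulmxKV // !mulmxBl.
(* Only four distinct products remain; as atoms they leave a linear identity in the signs. *)
do 4!move: (_ *m _ *m _ *m _) => ?.
by apply/matrixP=> i l; rewrite !mxE !exprS; ring.
Qed.

(** Multiply the recurrence by [(q j)^T]: its right-hand side vanishes because [r j] and [r j.+1]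
    are orthogonal. *)
Lemma normalized_residual_diag j : (j < k)%N ->
  (q j)^T *m (A *m q j - c j) = ta j.+1.
Proof.
move=> ltjk; rewrite -[_ - c j](subrK (q j *m ta j.+1)).
rewrite normalized_residual_rec //.
rewrite mulmxDr [X in _ + X]mulmxA normalized_residual_orth // mul1mx.
rewrite {1}/q [(_ *: _)^T]linearZ /= -scalemxAl -scalemxAr trmx_mul.
rewrite -!mulmxA (mulmxA (r j)^T).
rewrite (bcg_r_r A_posdef phi_unit dim_krylov ltjk (inv ltjk)) //.
by rewrite !mul0mx !mulmx0 !scaler0 add0r.
Qed.

Lemma normalized_residual_next j : (j.+1 < k)%N ->
  A *m q j - c j - q j *m ta j.+1 = q j.+1 *m tb j.+2.
Proof.
move=> ltjk; rewrite normalized_residual_rec ?(ltnW ltjk) // /q -scalemxAl /=.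
move: (bcg_rho_unitmx ltjk); move: (rho j.+1) (rho j) (gamma j) => s1 s g su1.
by rewrite !mulmxA mulmxKV.
Qed.

Lemma beta_tilde_unitmx j : (j.+1 < k)%N -> tb j.+2 \in unitmx.
Proof.
move=> ltjk; have ltjk' := ltnW ltjk.
move: (bcg_rho_unitmx ltjk) (bcg_rho_unitmx ltjk') (gamma_unit ltjk').
move: (phi_unit ltjk') => /=.
move: (rho j.+1) (rho j) (gamma j) => s1 s g fu su1 su gu.
by rewrite !unitmx_mul !unitmx_inv fu su1 su gu.
Qed.

(** Explains the initial value [(theta 0)^T] of the etas: it undoes the rotation in [rho 0] and
    leaves the triangular factor [bcg_sigma]. *)
Lemma residual_qr : (0 < k)%N ->
  is_qr (b - A *m x0) (q 0 *m (theta 0)^T) (bcg_sigma A b x0 phi 0).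
Proof.
move=> k0; have [sup _] := bcg_sigmaP k0; split=> //.
  by rewrite -mulmxA /q expr0 scale1r mulmxKV // bcg_rho_unitmx.
rewrite trmx_mul trmxK -mulmxA (mulmxA (q 0)^T) normalized_residual_orth //.
by rewrite mul1mx (mulmx1C (theta_orth k0)).
Qed.

End NormalizedResiduals.

Theorem theorem1 (R : realType) (n m : nat) (A : 'M[R]_n)
    (b x0 : 'M[R]_(n, m)) (phi theta : nat -> 'M[R]_m) (k : nat)
    (A_sym : A^T = A) (A_posdef : posdef A)
    (phi_unit : forall j : nat, (j < k)%N -> phi j \in unitmx)
    (theta_orth : forall j : nat, (j < k)%N -> orthogonal_mx (theta j))
    (k_gt0 : (0 < k)%N)
    (dim_krylov : \dim (krylov k A (b - A *m x0)) = (k * m)%N) :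
  let r0 := b - A *m x0 in
  let alpha := lanczos_alpha A r0 in
  let beta := lanczos_beta A r0 in
  let talpha := alpha_tilde A b x0 phi theta in
  let tbeta := beta_tilde A b x0 phi theta in
  let eta := qr_eta A b x0 phi theta in
  let T := block_tridiag k alpha beta in
  let Tt := block_tridiag k talpha tbeta in
  let U := block_diag k eta in
  T = U^T *m Tt *m U /\
  (forall j : nat, (1 <= j < k)%N ->
     is_qr (tbeta j.+1 *m eta j) (eta j.+1) (beta j.+1)).
Proof.
move=> r0 alpha beta talpha tbeta eta T Tt U.
pose q := normalized_residual A b x0 phi theta.
have q_orth : forall j, (j < k)%N -> (q j)^T *m q j = 1%:M.
  exact: normalized_residual_orth.
have q_diag :=
  normalized_residual_diag A_sym A_posdef phi_unit theta_orth dim_krylov.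
have q_next :=
  normalized_residual_next A_sym A_posdef phi_unit theta_orth dim_krylov.
have tb_unit := beta_tilde_unitmx A_sym A_posdef phi_unit theta_orth dim_krylov.
have e1_orth : (eta 1)^T *m eta 1 = 1%:M.
  by rewrite /eta /= trmxK (mulmx1C (theta_orth 0 k_gt0)).
have v_qr := residual_qr A_sym A_posdef phi_unit theta_orth dim_krylov k_gt0.
have e_rec j : (j.+1 < k)%N -> eta j.+2 = (qr (tbeta j.+2 *m eta j.+1)).1 by [].
split.
  exact: block_tridiag_similar q_orth q_diag q_next tb_unit e1_orth v_qr e_rec.
move=> j /andP[j_gt0 ltjk].
have [_ _ _] :=
  lanczos_similar q_orth q_diag q_next tb_unit e1_orth v_qr e_rec ltjk.
exact.
Qed.
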